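(* Let $A$ be an $N\times N$ Hermitian matrix with eigenvalues (counting multiplicities) $a_1\le a_2\le\dots\le a_N$, and let $k$ be an integer with $1\le k\le N$. Then the rank-$k$ numerical range satisfies $\Lambda_k(A)=[a_k,a_{N-k+1}]$, which is: (i) a non-degenerate closed interval if $a_k<a_{N-k+1}$; (ii) a singleton set if $a_k=a_{N-k+1}$; (iii) the empty set if $a_k>a_{N-k+1}$. Moreover, $$\Lambda_k(A)=\bigcap_{V} W(V^*AV),$$ where $V$ runs through all linear isometries $V:\mathbb{C}^{N-k+1}\to\mathbb{C}^N$.
   Context: For an $N\times N$ complex matrix $T$ and an integer $k\ge 1$, the rank-$k$ numerical range of $T$ is $$\Lambda_k(T)=\{\lambda\in\mathbb{C}: PTP=\lambda P \text{ for some rank-}k\text{ projection } P \text{ on } \mathbb{C}^N\},$$ where ''projection'' means orthogonal projection. The (classical) numerical range of an $n\times n$ matrix $S$ is $W(S)=\{\langle S\psi,\psi\rangle:\psi\in\mathbb{C}^n,\ \|\psi\|=1\}=\Lambda_1(S)$. For real $a,b$, $[a,b]=\{x\in\mathbb{R}:a\le x\le b\}$, which is empty when $a>b$. *)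

(* Defs.v *)
From mathcomp Require Import all_boot all_order all_algebra.
From mathcomp Require Import complex.
From mathcomp Require Import classical_sets set_interval reals.
Set Implicit Arguments.
Unset Strict Implicit.
Unset Printing Implicit Defensive.
Import Order.TTheory GRing.Theory Num.Theory.
Local Open Scope ring_scope.
Local Open Scope classical_set_scope.
Local Open Scope sesquilinear_scope.
Local Open Scope complex_scope.

(* Vectors of C^n are columns.  The library's standard dot product [dotmx] is
   defined on rows, is linear in its first argument, and conjugates the
   second one. *)
Definition inner (C : numClosedFieldType) (n : nat) (x y : 'cV[C]_n) : C :=
  dotmx x^T y^T.

Definition norm2 (C : numClosedFieldType) (n : nat) (x : 'cV[C]_n) : C :=
  sqrtC (inner x x).

Definition orthogonal_projection (C : numClosedFieldType) (n : nat)
    (P : 'M[C]_n) : Prop :=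
  P *m P = P /\ P ^t* = P.

Definition rank_numerical_range (C : numClosedFieldType) (n k : nat)
    (T : 'M[C]_n) : set C :=
  [set l | exists P : 'M[C]_n,
    [/\ orthogonal_projection P, \rank P = k & P *m T *m P = l *: P]].

Definition numerical_range (C : numClosedFieldType) (n : nat) (S : 'M[C]_n) :
    set C :=
  [set inner (S *m psi) psi | psi in [set psi : 'cV[C]_n | norm2 psi = 1]].

Definition linear_isometry (C : numClosedFieldType) (m n : nat)
    (V : 'M[C]_(n, m)) : Prop :=
  forall x : 'cV[C]_m, norm2 (V *m x) = norm2 x.

Definition real_segment (R : realType) (x y : R) : set R[i] :=
  [set t%:C | t in `[x, y]].

(* [s] lists the eigenvalues of [A], with multiplicities, in nondecreasing
   order. *)
Definition sorted_real_spectrum (R : realType) (n : nat) (A : 'M[R[i]]_n)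
    (s : n.-tuple R) : Prop :=
  char_poly A = \prod_(x <- s) ('X - (x%:C)%:P) /\ sorted <=%R s.

(* Main.v *)
Require Import Defs.
From mathcomp Require Import all_boot all_order all_algebra.
From mathcomp Require Import fingroup perm complex zify ring lra.
From mathcomp Require Import classical_sets set_interval reals.
Set Implicit Arguments.
Unset Strict Implicit.
Unset Printing Implicit Defensive.
Import Order.TTheory GRing.Theory Num.Theory.
Local Open Scope ring_scope.
Local Open Scope classical_set_scope.
Local Open Scope sesquilinear_scope.
Local Open Scope complex_scope.

(* The three sets are compared cyclically.  If [PAP = lP] with [P] of rank [k]
   and [V] is an isometry from [C^(N-k+1)], a unit vector in the intersection of
   the ranges of [P] and [V] shows that [l] lies in [W(V^*AV)].  Taking for [V]
   the inclusion of the span of the first, respectively last, [N-k+1]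
   eigenvectors bounds the intersection of the [W(V^*AV)] by [a_(N-k+1)] above
   and by [a_k] below.  Finally, for [t] between these bounds, pairing the [j]-th
   eigenvector from the bottom with the [j]-th from the top (and, if [2k > N],
   keeping the middle ones, whose eigenvalues are all [t]) gives [k] orthonormal
   vectors on whose span the compression of [A] is [t]. *)

Lemma char_poly_similar (F : comUnitRingType) n (P B : 'M[F]_n) :
  P \in unitmx -> char_poly (invmx P *m B *m P) = char_poly B.
Proof.
move=> Pu; rewrite /char_poly.
have -> : char_poly_mx (invmx P *m B *m P) =
    map_mx polyC (invmx P) *m char_poly_mx B *m map_mx polyC P.
  rewrite /char_poly_mx !map_mxM mulmxBr mulmxBl; congr (_ - _).
  by rewrite scalar_mxC -mulmxA -map_mxM mulVmx // map_mx1 mulmx1.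
by rewrite !det_mulmx mulrAC -det_mulmx -map_mxM mulVmx // map_mx1 det1 mul1r.
Qed.

(** * Inner products, isometries and compressions *)

Section Inner.
Context {C : numClosedFieldType}.

Lemma adjmxM m n p (A : 'M[C]_(m, n)) (B : 'M[C]_(n, p)) :
  (A *m B) ^t* = B ^t* *m A ^t*.
Proof. by rewrite trmx_mul map_mxM. Qed.

Lemma innerE n (x y : 'cV[C]_n) : inner x y = (y ^t* *m x) 0 0.
Proof.
by rewrite /inner dotmxE !mxE; apply: eq_bigr => i _; rewrite !mxE mulrC.
Qed.

Lemma inner_mulmxl m n (A : 'M[C]_(m, n)) (x : 'cV[C]_n) (y : 'cV[C]_m) :
  inner (A *m x) y = inner x (A ^t* *m y).
Proof. by rewrite !innerE adjmxM trmxCK mulmxA. Qed.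

Lemma innerZl n c (x y : 'cV[C]_n) : inner (c *: x) y = c * inner x y.
Proof. by rewrite !innerE -scalemxAr mxE. Qed.

Lemma innerxx n (x : 'cV[C]_n) : inner x x = \sum_i `|x i 0| ^+ 2.
Proof.
by rewrite innerE !mxE; apply: eq_bigr => i _; rewrite !mxE mulrC normCK.
Qed.

Lemma inner_ge0 n (x : 'cV[C]_n) : 0 <= inner x x.
Proof. by rewrite innerxx sumr_ge0 // => i _; rewrite exprn_ge0. Qed.

Lemma norm2_eq0 n (x : 'cV[C]_n) : (norm2 x == 0) = (x == 0).
Proof.
rewrite /norm2 sqrtC_eq0 innerxx; apply/eqP/eqP => [|->]; last first.
  by rewrite big1 // => i _; rewrite mxE normr0 expr0n.
move=> /psumr_eq0P x0; apply/colP => i; rewrite mxE; apply/eqP.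
by rewrite -normr_eq0 -[_ == 0](expf_eq0 _ 2) x0 // => j _; rewrite exprn_ge0.
Qed.

Lemma norm2Z n c (x : 'cV[C]_n) : norm2 (c *: x) = `|c| * norm2 x.
Proof.
rewrite /norm2 !innerxx; under eq_bigr do rewrite mxE normrM exprMn.
rewrite -mulr_sumr sqrtCM ?nnegrE ?exprn_ge0 ?sqrCK //.
by apply: sumr_ge0 => i _; rewrite exprn_ge0.
Qed.

Lemma norm2_eq1 n (x : 'cV[C]_n) : (norm2 x = 1) <-> (inner x x = 1).
Proof.
rewrite /norm2; split=> [x1|->]; last exact: sqrtC1.
by rewrite -[LHS]sqrtCK x1 expr1n.
Qed.

Lemma unitary_adj_isometry m n (V : 'M[C]_(n, m)) :
  V ^t* *m V = 1%:M -> linear_isometry V.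
Proof.
by move=> V1 x; rewrite /norm2 inner_mulmxl mulmxA V1 mul1mx.
Qed.

Lemma unit_kernel_vector m n (B : 'M[C]_(n, m)) :
  (\rank B < m)%N -> exists2 psi : 'cV[C]_m, norm2 psi = 1 & B *m psi = 0.
Proof.
move=> rB.
have : kermx B^T != 0 by rewrite kermx_eq0 /row_free mxrank_tr neq_ltn rB.
case/rowV0Pn => v /sub_kermxP vB v0.
have u0 : norm2 v^T != 0.
  by rewrite norm2_eq0 -(inj_eq (@trmx_inj _ _ _)) trmxK trmx0.
have u_ge0 : 0 <= norm2 v^T by rewrite /norm2 sqrtC_ge0 inner_ge0.
exists ((norm2 v^T)^-1 *: v^T).
  by rewrite norm2Z normfV ger0_norm // mulVf.
by rewrite -scalemxAr -[B]trmxK -trmx_mul vB trmx0 scaler0.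
Qed.

(* The range of a rank-[k] projection [P] meets the range of [V]: otherwise
   [(1 - P) V] would be injective, while its rank is at most [N - k]. *)
Lemma rank_numerical_range_sub_compression N k m (T : 'M[C]_N)
    (V : 'M[C]_(N, m)) :
  linear_isometry V -> (N - k < m)%N ->
  rank_numerical_range k T `<=` numerical_range (V ^t* *m T *m V).
Proof.
move=> isoV ltm l [P [[PP Padj] rP PTP]].
have rQ : (\rank ((1%:M - P) *m V) < m)%N.
  apply: leq_ltn_trans ltm; apply: leq_trans (mxrankM_maxl _ _) _.
  have: (1%:M - P) *m P = 0 by rewrite mulmxBl mul1mx PP subrr.
  move/mulmx0_rank_max; rewrite rP leq_subRL 1?addnC //.
  by rewrite -rP rank_leq_row.
have [psi psi1] := unit_kernel_vector rQ.
rewrite -mulmxA mulmxBl mul1mx => /eqP; rewrite subr_eq0 => /eqP Px.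
exists psi => //=.
have x1 : inner (V *m psi) (V *m psi) = 1 by apply/norm2_eq1; rewrite isoV.
(* With [x = V psi] a unit vector fixed by the self-adjoint [P],
   [<T x, x> = <P T P x, x> = l <x, x> = l]. *)
rewrite -!mulmxA inner_mulmxl trmxCK Px.
rewrite -[in X in inner _ X]Padj -inner_mulmxl !mulmxA PTP -!scalemxAl innerZl.
by rewrite -[P *m V *m psi]mulmxA -Px x1 mulr1.
Qed.

Lemma unitary_compression_scalar N k (T : 'M[C]_N) (W : 'M[C]_(k, N)) l :
  W \is unitarymx -> W *m T *m W ^t* = l%:M -> rank_numerical_range k T l.
Proof.
move=> Wu WT; exists (W ^t* *m W); split; first split.
- by rewrite mulmxA mulmxtVK.
- by rewrite adjmxM trmxCK.
- apply/anti_leq/andP; split.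
    by rewrite (leq_trans (mxrankM_maxr _ _)) ?rank_leq_row.
  rewrite -[X in (X <= _)%N](mxrank_unitary Wu).
  rewrite -[X in (\rank X <= _)%N]mul1mx -(unitarymxP Wu) -mulmxA.
  exact: mxrankM_maxr.
- transitivity (W ^t* *m (W *m T *m W ^t*) *m W); first by rewrite !mulmxA.
  by rewrite WT mul_mx_scalar scalemxAl.
Qed.

(** The columns of [V] are orthonormal eigenvectors of [A] for the values [d 0 (f i)], so [V^* A V]
    is diagonal; the weights are the squared moduli of the coordinates of a unit vector. *)
Lemma numerical_range_eigen_compression N m (A U : 'M[C]_N) (d : 'rV[C]_N)
    (f : 'I_m -> 'I_N) z :
  A = U ^t* *m diag_mx d *m U -> U \is unitarymx -> injective f ->
  let V := (rowsub f U) ^t* in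
  linear_isometry V /\
  (numerical_range (V ^t* *m A *m V) z ->
   exists w : 'I_m -> C, [/\ forall i, 0 <= w i, \sum_i w i = 1 &
     z = \sum_i w i * d 0 (f i)]).
Proof.
move=> -> Uu f_inj V.
have VV X : V ^t* *m X *m V = mxsub f f (U *m X *m U ^t*).
  rewrite mxsub_mul -mul_rowsub_mx trmxCK; congr (_ *m _).
  by apply/matrixP => i j; rewrite !mxE.
have fE (e : 'rV_N) : mxsub f f (diag_mx e) = diag_mx (colsub f e).
  by apply/matrixP => i j; rewrite !mxE (inj_eq f_inj).
split.
  apply: unitary_adj_isometry.
  rewrite -[V ^t*]mulmx1 VV mulmx1 (unitarymxP Uu).
  by apply/matrixP => i j; rewrite !mxE (inj_eq f_inj).
rewrite VV !mulmxA (unitarymxP Uu) mul1mx mulmxtVK // fE.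
move=> [psi /norm2_eq1 psi1 <-]; exists (fun i => `|psi i 0| ^+ 2); split.
- by move=> i; rewrite exprn_ge0.
- by rewrite -innerxx.
- rewrite innerE mul_diag_mx mxE; apply: eq_bigr => i _.
  by rewrite !mxE normCK mulrCA mulrC; congr (_ * _); exact: mulrC.
Qed.

(** The spectral theorem lists the eigenvalues in an order of its own. The characteristic polynomial
    makes that list a permutation of [d], and permuting the rows of the unitary matrix accordingly
    yields the order of [d]. *)
Lemma normal_diagonalization N (A : 'M[C]_N) (d : N.-tuple C) :
  A \is normalmx -> char_poly A = \prod_(x <- d) ('X - x%:P) ->
  exists2 U : 'M[C]_N, U \is unitarymx &
    A = U ^t* *m diag_mx (\row_i tnth d i) *m U.
Proof.
move=> /orthomx_spectralP; set P := spectralmx A; set e := spectral_diag A.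
move=> Ae; have Pu : P \is unitarymx := spectral_unitarymx A.
have -> : char_poly A = \prod_(x <- [tuple e 0 i | i < N]) ('X - x%:P).
  rewrite Ae char_poly_similar ?unitarymx_unit // char_poly_trig //.
  rewrite big_tuple; apply: eq_bigr => i _.
  by rewrite tnth_mktuple mxE eqxx mulr1n.
move=> /prod_XsubC_eq; rewrite perm_sym => /tuple_permP[p dE].
exists (row_perm p P).
  rewrite row_permE mul_unitarymx //; apply/unitarymxP.
  by rewrite tr_perm_mx map_perm_mx -perm_mxM mulgV perm_mx1.
rewrite {1}Ae invmx_unitary //; apply/matrixP => i j; rewrite !mul_mx_diag !mxE.
rewrite (reindex_inj (@perm_inj _ p)); apply: eq_bigr => l _; rewrite !mxE.
by rewrite (tnth_nth 0) dE -tnth_nth !tnth_mktuple.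
Qed.

End Inner.

(** * Orthonormal vectors realizing a prescribed real value *)

Section Segment.
Variable R : rcfType.

Lemma unit_circle_weights (a b t : R) : a <= t <= b ->
  exists xy : R * R, xy.1 ^+ 2 + xy.2 ^+ 2 = 1 /\
                     xy.1 ^+ 2 * a + xy.2 ^+ 2 * b = t.
Proof.
move=> /andP[le_at le_tb]; have [eq_ab|neq_ab] := eqVneq a b.
  by exists (1, 0); split=> /=; [ring | rewrite eq_ab; lra].
have lt_ab : 0 < b - a by rewrite subr_gt0 lt_neqAle neq_ab (le_trans le_at).
exists (Num.sqrt ((b - t) / (b - a)), Num.sqrt ((t - a) / (b - a))) => /=.
rewrite !sqr_sqrtr ?divr_ge0 ?subr_ge0 ?(le_trans le_at) //.
by split; field; rewrite subr_eq0 eq_sym.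
Qed.

Lemma sum_pick N m (c : R) (h : nat -> R) : (m < N)%N ->
  \sum_(i < N) c *+ (i == m :> nat) * h i = c * h m.
Proof.
move=> ltm; rewrite (bigD1 (Ordinal ltm)) //= eqxx big1 ?addr0 // => i.
by rewrite -val_eqE /= => /negPf ->; rewrite mulr0n mul0r.
Qed.

(* The basis vectors [e_j] and [e_(N-1-j)] are paired when [j < N - k], the
   remaining [e_j] being kept alone; the [k] planes and lines so obtained are
   pairwise orthogonal, even when [2k > N]. *)
Lemma antipodal_pairing N k (d : nat -> R) (t : R) : (1 <= k <= N)%N ->
  (forall i j, (i <= j < N)%N -> d i <= d j) ->
  d (k - 1)%N <= t <= d (N - k)%N ->
  exists2 W : 'M[R[i]]_(k, N), W \is unitarymx &
    W *m diag_mx (\row_i (d i)%:C) *m W ^t* = (t%:C)%:M.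
Proof.
move=> hk d_mono /andP[lo_t t_hi].
have /fin_all_exists[f fP] : forall j : 'I_k, exists xy : R * R,
    [/\ xy.1 ^+ 2 + xy.2 ^+ 2 = 1,
        xy.1 ^+ 2 * d j + xy.2 ^+ 2 * d (N - 1 - j)%N = t &
        (N - k <= j)%N -> xy.2 = 0].
  move=> j; have ltjk := ltn_ord j.
  (* If [N - k <= j <= k - 1], monotonicity gives [d j <= d (k - 1) <= t <= d (N - k) <= d j], so
     [e_j] alone suffices. Otherwise [d j <= t <= d (N - 1 - j)]. *)
  have [le_j|lt_j] := leqP (N - k) j.
    exists (1, 0); split=> //=; first by ring.
    suff -> : d j = t by ring.
    by apply/eqP; rewrite eq_le (le_trans _ lo_t) ?(le_trans t_hi) // d_mono //;
      lia.
  have [|xy [xy1 xyt]] := @unit_circle_weights (d j) (d (N - 1 - j)%N) t.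
    by rewrite (le_trans _ lo_t) ?(le_trans t_hi) // d_mono //; lia.
  by exists xy; split=> // /(leq_trans lt_j); rewrite ltnn.
pose w (j : 'I_k) (i : nat) : R :=
  (f j).1 *+ (i == j) + (f j).2 *+ (i == N - 1 - j)%N.
pose W : 'M[R[i]]_(k, N) := \matrix_(j, i) (w j i)%:C.
(* One computation serves twice: [g = 1] gives orthonormality of the rows, [g = d] gives the
   compression. *)
have gram (g : nat -> R) : W *m diag_mx (\row_i (g i)%:C) *m W ^t* =
    \matrix_(j, l) (((f j).1 ^+ 2 * g j + (f j).2 ^+ 2 * g (N - 1 - j)%N)
                    *+ (j == l))%:C.
  apply/matrixP => j l; rewrite mul_mx_diag !mxE.
  transitivity (\sum_(i < N) w j i * (g i * w l i))%:C.
    rewrite rmorph_sum; apply: eq_bigr => i _.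
    by rewrite !mxE !rmorphM /= mulrA; congr (_ * _); exact: conjc_real.
  congr _%:C; rewrite /w; under eq_bigr do rewrite mulrDl.
  have [ltj ltl] := (ltn_ord j, ltn_ord l).
  rewrite big_split /=.
  rewrite (sum_pick _ (fun i => g i * w l i)); last by lia.
  rewrite (sum_pick _ (fun i => g i * w l i)); last by lia.
  (* If [j = N - 1 - l], then [j < k] forces [N - k <= l], where the second weight vanishes. *)
  have -> : w l j = (f l).1 *+ (j == l).
    rewrite /w val_eqE.
    case: (eqVneq (j : nat) (N - 1 - l)%N) => [jl|_]; last first.
      by rewrite mulr0n addr0.
    have [_ _ ->] := fP l; rewrite ?mul0rn ?addr0 //.
    by clear -hk ltj ltl jl; lia.
  have [lt_j|le_j] := ltnP j (N - k); last first.
    have [_ _ /(_ le_j) ->] := fP j; rewrite mul0r expr0n mul0r !addr0.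
    by case: eqVneq => [->|_]; rewrite ?mulr1n ?mulr0n; ring.
  (* Here [j < N - k], hence [N - 1 - j >= k > l]. *)
  have -> : w l (N - 1 - j)%N = (f l).2 *+ (j == l).
    rewrite /w; have -> : (N - 1 - j == l)%N = false by lia.
    rewrite mulr0n add0r; congr (_ *+ nat_of_bool _).
    by rewrite -(inj_eq val_inj) /=; clear -hk ltj ltl; lia.
  by case: eqVneq => [->|_]; rewrite ?mulr1n ?mulr0n; ring.
exists W.
  apply/unitarymxP; have := gram (fun=> 1).
  have -> : \row_(i < N) (1 : R)%:C = const_mx 1.
    by apply/rowP => i; rewrite !mxE.
  rewrite diag_const_mx mulmx1 => ->; apply/matrixP => j l; rewrite !mxE.
  by have [xy1 _ _] := fP j; rewrite !mulr1 xy1 rmorphMn.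
rewrite gram; apply/matrixP => j l; rewrite !mxE.
by have [_ -> _] := fP j; rewrite rmorphMn.
Qed.

End Segment.

Lemma convex_combination_bounds (C : numDomainType) (I : finType)
    (w d : I -> C) (x y : C) :
  (forall i, 0 <= w i) -> \sum_i w i = 1 -> (forall i, x <= d i <= y) ->
  x <= \sum_i w i * d i <= y.
Proof.
move=> w0 w1 d_xy; rewrite -(mul1r x) -(mul1r y) -w1 !mulr_suml.
by apply/andP; split; apply: ler_sum => i _; rewrite ler_wpM2l //;
  case/andP: (d_xy i).
Qed.

Theorem theorem2p4 (R : realType) (N k : nat) (A : 'M[R[i]]_N) (a : N.-tuple R)
    (hA : A \is hermsymmx) (ha : sorted_real_spectrum A a)
    (hk : (1 <= k <= N)%N) :
  (* the list [a] is indexed from 0, so a_k and a_(N-k+1) are: *)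
  let lo : R := a`_(k - 1) in
  let hi : R := a`_(N - k) in
  [/\ rank_numerical_range k A = real_segment lo hi,
      lo < hi -> exists x y : R,
        x < y /\ rank_numerical_range k A = real_segment x y,
      lo = hi -> exists z : R[i], rank_numerical_range k A = [set z],
      hi < lo -> rank_numerical_range k A = set0 &
      rank_numerical_range k A =
        \bigcap_(V in [set V : 'M[R[i]]_(N, N - k + 1) | linear_isometry V])
          numerical_range (V ^t* *m A *m V)].
Proof.
move=> lo hi; have [charA a_sorted] := ha.
have a_mono i j : (i <= j < N)%N -> a`_i <= a`_j.
  move=> /andP[ij jN]; apply: (sorted_leq_nth le_trans lexx) => //.
    by rewrite inE size_tuple (leq_ltn_trans ij).
  by rewrite inE size_tuple.
have [U Uu AE] : exists2 U : 'M[R[i]]_N, U \is unitarymx &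
    A = U ^t* *m diag_mx (\row_i (a`_i)%:C) *m U.
  have [|U Uu ->] := @normal_diagonalization _ N A
    (map_tuple (real_complex R) a) (hermitian_normalmx hA).
    by rewrite charA big_map.
  exists U => //; congr (_ *m diag_mx _ *m _); apply/rowP => i.
  by rewrite !mxE tnth_map (tnth_nth 0).
set capV := \bigcap_(V in _) _.
have sub_cap : rank_numerical_range k A `<=` capV.
  move=> z Az V isoV; apply: rank_numerical_range_sub_compression Az => //.
  by rewrite addn1.
have cap_bounds z (f : 'I_(N - k + 1) -> 'I_N) (x y : R) : injective f ->
    (forall i, x <= a`_(f i) <= y) -> capV z -> x%:C <= z <= y%:C.
  move=> f_inj f_xy capz.
  have [isoV WV] := numerical_range_eigen_compression z AE Uu f_inj.
  have [w [w0 w1 ->]] := WV (capz _ isoV).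
  by apply: convex_combination_bounds => // i; rewrite mxE !lecR.
have cap_seg : capV `<=` real_segment lo hi.
  move=> z capz.
  (* Counting from 0, the first [N - k + 1] indices end at [N - k] and the last ones start at
     [k - 1]. *)
  have ltl (i : 'I_(N - k + 1)) : (i < N)%N by have := ltn_ord i; lia.
  have ltr (i : 'I_(N - k + 1)) : (k - 1 + i < N)%N by have := ltn_ord i; lia.
  have /andP[_ z_hi] : (a`_0)%:C <= z <= hi%:C.
    apply: (cap_bounds _ (fun i => Ordinal (ltl i))) => // [i j []|i].
      exact: val_inj.
    by rewrite /= !a_mono //; have := ltn_ord i; lia.
  have /andP[lo_z _] : lo%:C <= z <= (a`_(N - 1))%:C.
    apply: (cap_bounds _ (fun i => Ordinal (ltr i))) => // [i j [] /addnI|i].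
      exact: val_inj.
    by rewrite /= !a_mono //; have := ltn_ord i; lia.
  (* Comparability with a real number in the order of [R[i]] forces [z] to be real. *)
  move: z_hi lo_z; rewrite !lecE /= => /andP[/eqP Iz z_hi] /andP[_ lo_z].
  exists (complex.Re z); first by rewrite /= in_itv /= lo_z z_hi.
  by rewrite [RHS]complexE -Iz mulr0 addr0.
have seg_sub : real_segment lo hi `<=` rank_numerical_range k A.
  move=> _ [t /= t_itv <-].
  have [W Wu WD] := antipodal_pairing hk a_mono t_itv.
  apply: (@unitary_compression_scalar _ _ _ _ (W *m U)).
    exact: mul_unitarymx.
  by rewrite adjmxM AE !mulmxA mulmxtVK // [_ *m U *m _]mulmxtVK.
have rangeE : rank_numerical_range k A = real_segment lo hi.
  by rewrite eqEsubset; split=> // z /sub_cap /cap_seg.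
split=> //.
- by move=> lt_lohi; exists lo, hi.
- move=> eq_lohi; exists lo%:C; rewrite rangeE /real_segment -eq_lohi.
  by rewrite set_itv1 image_set1.
- move=> lt_hilo; rewrite rangeE /real_segment set_itv_ge ?image_set0 //.
  by rewrite bnd_simp -ltNge.
- by rewrite eqEsubset; split=> // z /cap_seg /seg_sub.
Qed.
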